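(* Let $G$ be an abelian group of odd order $n > 5$. Then $$\mathrm{sat}(3\text{-}\mathrm{AP},G) \leq \mathrm{sat}((1/2,1/2),G) \leq \sqrt{(n-1)\ln(n-1)}+ \sqrt{n-1}+1.$$
   Context: A $3$-AP of $G$ is a set of three distinct elements of the form $g,g+d,g+2d$ with $g,d\in G$. A set $S\subseteq G$ is $3$-AP saturating if for each $x\in G\setminus S$ there is a $3$-AP of $G$ consisting of $x$ and two elements of $S$; $\mathrm{sat}(3\text{-}\mathrm{AP},G)$ is the minimum size of such a set. As $G$ has odd order, $\frac12 g$ denotes the unique $x\in G$ with $x+x=g$. A set $A\subseteq G$ is $(\frac12,\frac12)$-saturating if for each $x\in G\setminus A$ there are $a',a''\in A$, $a'\neq a''$, with $x=\frac12a'+\frac12a''$; $\mathrm{sat}((1/2,1/2),G)$ is the minimum size of such a set. *)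

(* Defs.v *)
From HB Require Import structures.
From mathcomp Require Import all_boot all_order all_algebra.

Set Implicit Arguments.
Unset Strict Implicit.
Unset Printing Implicit Defensive.

Import GRing.Theory.
Local Open Scope ring_scope.

(* A finite abelian group, written additively, is a [finZmodType]. *)

Definition is_3AP (G : finZmodType) (T : {set G}) : bool :=
  (#|T| == 3)%N && [exists g, exists d, T == [set g; g + d; g + d *+ 2]].

(* "Two elements of S": since [is_3AP] forces cardinality 3, the elements
   x, s, s' below are pairwise distinct. *)
Definition AP3_saturating (G : finZmodType) (S : {set G}) : bool :=
  [forall x in ~: S, exists s in S, exists s' in S, is_3AP [set x; s; s']].

(* The junk value 0 is only used when no x satisfies x + x = g, which never
   happens in odd order: see [halfP]. *)
Definition half (G : finZmodType) (g : G) : G :=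
  odflt 0 [pick x | x + x == g].

Definition half_saturating (G : finZmodType) (A : {set G}) : bool :=
  [forall x in ~: A, exists a in A, exists a' in A,
    (a != a') && (x == half a + half a')].

(* The minima are taken over nonempty families: see [AP3_saturating_setT] and
   [half_saturating_setT]. *)
Definition sat_3AP (G : finZmodType) : nat :=
  #|[arg min_(S < [set: G] | AP3_saturating S) #|S| ]|.

Definition sat_half (G : finZmodType) : nat :=
  #|[arg min_(A < [set: G] | half_saturating A) #|A| ]|.

Lemma AP3_saturating_setT (G : finZmodType) : AP3_saturating [set: G].
Proof. by apply/'forall_implyP => x; rewrite setCT inE. Qed.

Lemma half_saturating_setT (G : finZmodType) : half_saturating [set: G].
Proof. by apply/'forall_implyP => x; rewrite setCT inE. Qed.

Lemma halfP (G : finZmodType) (g x : G) :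
  odd #|G| -> (x + x == g) = (x == half g).
Proof.
move=> oddG.
have cardG (y : G) : y *+ #|G| = 0.
  have : \sum_(z : G) z = \sum_(z : G) (y + z) by exact: (reindex_inj (addrI y)).
  rewrite big_split /= sumr_const => /eqP.
  by rewrite -[X in X == _]add0r (inj_eq (addIr _)) => /eqP <-.
have dbl_half (y : G) : (y + y) *+ (#|G|.+1)./2 = y.
  rewrite -mulr2n -mulrnA mul2n.
  have -> : ((#|G|.+1)./2).*2 = #|G|.+1.
    by rewrite -[RHS]odd_double_half /= oddG.
  by rewrite mulrS cardG addr0.
have half_dbl (y : G) : y *+ (#|G|.+1)./2 + y *+ (#|G|.+1)./2 = y.
  by rewrite -mulrnDl dbl_half.
have hK : half g + half g = g.
  rewrite /half; case: pickP => [y /eqP // | no].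
  by have := no (g *+ (#|G|.+1)./2); rewrite half_dbl eqxx.
apply/eqP/eqP => [xg | -> //].
by rewrite -[x]dbl_half -[half g]dbl_half hK xg.
Qed.

(* Main.v *)
(** Since [x = half a + half a'] means [x + x = a + a'], an element [x] outside
    [A] is covered as soon as [A] contains both [x + d] and [x - d] for some
    [d != 0].  Put each element in a random [A] independently with probability
    [p].  With [n = #|G|] and [m = n - 1], the [m / 2] pairs [{x + d, x - d}] are
    disjoint and avoid [x], so [x] is neither in [A] nor covered with probability
    at most [(1 - p) (1 - p^2)^(m / 2)].  Adding the uncovered elements to [A]
    yields a saturating set of expected size at most
    [n (p + (1 - p) (1 - p^2)^(m / 2))].  For [p = sqrt (ln m / m)] the power is
    at most [1 / sqrt m], and [n = m + 1] gives
    [sqrt (m ln m) + (1 - p) sqrt m + p + (1 - p) / sqrt m]. *)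

Require Import Defs.
From mathcomp Require Import all_boot all_order all_algebra.
From mathcomp Require Import ring lra zify.
From mathcomp Require Import reals sequences exp.

Import Order.TTheory GRing.Theory Num.Theory.
Local Open Scope ring_scope.

Set Implicit Arguments.
Unset Strict Implicit.
Unset Printing Implicit Defensive.

(* The law of a random subset containing each element independently with
   probability [p]. *)
Definition bernoulli_weight (R : comPzRingType) (T : finType) (p : R)
    (A : {set T}) : R :=
  \prod_x (if x \in A then p else 1 - p).

Definition mean (R : comPzRingType) (T : finType) (p : R) (F : {set T} -> R) : R :=
  \sum_A bernoulli_weight p A * F A.

(** * Expectation over random subsets *)

Section Mean.
Variables (R : comPzRingType) (T : finType) (p : R).
Implicit Types (A : {set T}) (F g : {set T} -> R).

Lemma eq_mean F g : F =1 g -> mean p F = mean p g.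
Proof. by move=> eqFg; apply: eq_bigr => A _; rewrite eqFg. Qed.

Lemma meanD F g : mean p (fun A => F A + g A) = mean p F + mean p g.
Proof. by rewrite -big_split; apply: eq_bigr => A _; rewrite mulrDr. Qed.

Lemma meanB F g : mean p (fun A => F A - g A) = mean p F - mean p g.
Proof. by rewrite /mean -sumrB; apply: eq_bigr => A _; rewrite mulrBr. Qed.

Lemma mean_sum (I : finType) (F : I -> {set T} -> R) :
  mean p (fun A => \sum_i F i A) = \sum_i mean p (F i).
Proof.
by rewrite exchange_big; apply: eq_bigr => A _; rewrite mulr_sumr.
Qed.

Lemma mean1 : mean p (fun _ : {set T} => 1) = 1.
Proof.
transitivity (\prod_(x : T) (p + (1 - p))).
  rewrite bigA_distr; apply: eq_bigr => A _.
  by rewrite mulr1.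
by rewrite big1 // => x _; rewrite addrC subrK.
Qed.

(** The two weights differ only in the factor at [u]: [p] against [1 - p]. Cross-multiplying avoids
    division in [R]. *)
Lemma bernoulli_weightU1 u A : u \notin A ->
  (1 - p) * bernoulli_weight p (u |: A) = p * bernoulli_weight p A.
Proof.
move=> uA; rewrite /bernoulli_weight (bigD1 u) //= [in RHS](bigD1 u) //=.
rewrite setU11 (negPf uA) mulrCA; congr (_ * (_ * _)).
by apply: eq_bigr => x /negPf xu; rewrite !inE xu.
Qed.

(* The hypothesis says that [g] does not depend on whether [u] is in [A], so it
   is independent of that event. *)
Lemma mean_in u g : (forall A, g (u |: A) = g A) ->
  mean p (fun A => (u \in A)%:R * g A) = p * mean p g.
Proof.
move=> gU; rewrite /mean [in RHS](bigID (fun A => u \in A)) mulrDr /=.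
set S1 := \sum_(A : {set T} | u \in A) _.
(* Adding [u] matches the sets without [u] to those with it, so the two parts sum to
   [p * S1 + (1 - p) * S1 = S1]. *)
have -> : p * (\sum_(A : {set T} | u \notin A) bernoulli_weight p A * g A)
          = (1 - p) * S1.
  rewrite /S1 [in RHS](reindex_onto (fun A => u |: A) (fun A => A :\ u)) /=;
    last by move=> A; apply: setD1K.
  rewrite !mulr_sumr; apply: eq_big => [A | A uA].
    rewrite setU11; apply/idP/eqP => [/setU1K // | <-].
    by rewrite !inE eqxx.
  by rewrite gU !mulrA bernoulli_weightU1.
rewrite -mulrDl addrC subrK mul1r (bigID (fun A => u \in A)) /= addrC big1.
  by rewrite add0r; apply: eq_bigr => A ->; rewrite mul1r.
by move=> A /negPf->; rewrite mul0r mulr0.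
Qed.

(** Distinctness makes the events independent; induction on [s] splits off a factor [1 - p ^+ 2] per
    pair. *)
Lemma mean_avoid_pairs x (s : seq (T * T)) :
  uniq (x :: unzip1 s ++ unzip2 s) ->
  mean p (fun A => ((x \notin A) &&
                    all (fun c => ~~ ((c.1 \in A) && (c.2 \in A))) s)%:R)
  = (1 - p) * (1 - p ^+ 2) ^+ size s.
Proof.
pose Q s A := all (fun c : T * T => ~~ ((c.1 \in A) && (c.2 \in A))) s.
have QU u t A : u \notin unzip1 t -> u \notin unzip2 t -> Q t (u |: A) = Q t A.
  move=> u1 u2; apply: eq_in_all => c ct; rewrite !inE.
  have /negPf-> : c.1 != u by apply: contraNneq u1 => <-; apply: map_f.
  by have /negPf-> : c.2 != u by apply: contraNneq u2 => <-; apply: map_f.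
elim: s => [|[u v] s IHs].
  rewrite expr0 mulr1 => _.
  transitivity (mean p (fun A => 1 - (x \in A)%:R * 1)).
    apply: eq_mean => A; rewrite andbT mulr1.
    by case: (x \in A); rewrite /= ?subrr ?subr0.
  by rewrite meanB mean_in // mean1 mulr1.
have /perm_uniq-> : perm_eq (x :: unzip1 ((u, v) :: s) ++ unzip2 ((u, v) :: s))
                            [:: u, v, x & unzip1 s ++ unzip2 s].
  by apply/permP => a; rewrite /= !count_cat /=; lia.
rewrite 2!cons_uniq 3!in_cons !mem_cat !negb_or.
move=> /and3P[/and4P[uv ux u1 u2] /and3P[vx v1 v2] /IHs{}IHs].
pose g A : R := ((x \notin A) && Q s A)%:R.
have gU w A : w != x -> w \notin unzip1 s -> w \notin unzip2 s -> g (w |: A) = g A.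
  by move=> wx w1 w2; rewrite /g QU // in_setU1 eq_sym (negPf wx).
(* Subtract the event that [u] and [v] both lie in [A]; as [g] ignores both, [mean_in] applies
   twice. *)
transitivity (mean p (fun A => g A - (u \in A)%:R * ((v \in A)%:R * g A))).
  apply: eq_mean => A; rewrite /g /Q.
  rewrite /=; case: (x \in A) (u \in A) (v \in A) (all _ _) => -[] [] [] /=;
    by rewrite !(mul1r, mul0r, mulr0, subrr, subr0).
rewrite meanB mean_in => [|A]; last first.
  by rewrite gU // in_setU1 eq_sym (negPf uv).
rewrite mean_in => [|A]; last by rewrite gU.
rewrite [mean p g]IHs /= [X in _ = _ * X]exprS; ring.
Qed.

End Mean.

(** The weights are nonnegative with sum 1, so a minimizer of [F] works. *)
Lemma le_mean_exists (R : realDomainType) (T : finType) (p : R)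
    (F : {set T} -> R) : 0 <= p <= 1 -> exists A, F A <= mean p F.
Proof.
move=> /andP[p0 p1].
have w0 A : 0 <= bernoulli_weight p A.
  by apply: prodr_ge0 => x _; case: ifP; rewrite ?subr_ge0.
pose A0 := [arg min_(A < (set0 : {set T})) F A]%O.
exists A0; rewrite -[F A0]mul1r -[X in X * _](mean1 T p) mulr_suml.
apply: ler_sum => A _; rewrite mulr1 ler_wpM2l //.
by rewrite /A0; case: arg_minP => // B _; apply.
Qed.

(** * Saturation in groups of odd order *)

Section OddOrder.
Variable G : finZmodType.
Hypothesis oddG : odd #|G|.
Implicit Types (A S : {set G}) (x a : G).

Lemma eq_half x a a' : (x == Defs.half a + Defs.half a') = (x + x == a + a').
Proof.
have dbl (b : G) : Defs.half b + Defs.half b = b by apply/eqP; rewrite halfP.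
rewrite halfP //; congr (x == _); apply/eqP.
by rewrite -halfP // addrACA !dbl.
Qed.

Lemma addrr_eq0 x : (x + x == 0) = (x == 0).
Proof.
rewrite halfP //; congr (x == _).
by apply/esym/eqP; rewrite -halfP // addr0.
Qed.

Lemma half_saturatingP A :
  reflect (forall x, x \notin A -> exists a a',
             [/\ a \in A, a' \in A, a != a' & x + x = a + a'])
          (half_saturating A).
Proof.
apply: (iffP forall_inP) => satA x.
  rewrite -in_setC => /satA /exists_inP[a aA /exists_inP[a' a'A]].
  by rewrite eq_half => /andP[aa' /eqP xx]; exists a, a'.
rewrite in_setC => /satA[a [a' [aA a'A aa' /eqP xx]]].
by apply/exists_inP; exists a => //; apply/exists_inP; exists a' => //;
  rewrite aa' eq_half.
Qed.

(** If [x + x = a + a'], then [a, x, a'] is a progression with difference [x - a]. *)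
Lemma half_saturating_AP3 A : half_saturating A -> AP3_saturating A.
Proof.
move=> /half_saturatingP satA; apply/forall_inP => x; rewrite in_setC => xA.
have [a [a' [aA a'A aa' xx]]] := satA x xA.
apply/exists_inP; exists a => //; apply/exists_inP; exists a' => //.
have xa : x != a by apply: contraNneq xA => ->.
have xa' : x != a' by apply: contraNneq xA => ->.
apply/andP; split.
  by rewrite -setUA cardsU1 cards2 !inE aa' negb_or xa xa'.
apply/existsP; exists a; apply/existsP; exists (x - a).
have -> : a + (x - a) = x by rewrite addrC subrK.
have -> : a + (x - a) *+ 2 = a'.
  by rewrite mulr2n addrACA -opprD xx opprD [a + a' + _]addrACA
              subrr add0r addrCA subrr addr0.
by rewrite (setUC [set x]).
Qed.

Lemma sat_half_le A : half_saturating A -> (sat_half G <= #|A|)%N.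
Proof.
rewrite /sat_half => satA.
by case: arg_minnP => [|B _]; [exact: half_saturating_setT | apply].
Qed.

Lemma sat_3AP_le_half : (sat_3AP G <= sat_half G)%N.
Proof.
rewrite /sat_3AP; case: arg_minnP => [|S _]; first exact: AP3_saturating_setT.
apply; rewrite /sat_half; apply: half_saturating_AP3.
by case: arg_minnP => [|//]; exact: half_saturating_setT.
Qed.

(* One representative of each pair [{d, -d}] with [d != 0]. *)
Definition positives : {set G} :=
  [set d | (enum_rank d < enum_rank (- d)%R)%N].

Lemma positivesN d : d \in positives -> - d \notin positives.
Proof. by rewrite !inE opprK -leqNgt => /ltnW. Qed.

Lemma positives_neq0 d : d \in positives -> d != 0.
Proof. by apply: contraTneq => ->; rewrite inE oppr0 ltnn. Qed.

(** [positives] and its negation are disjoint and miss only 0, since [d = - d] forces [d = 0] in odd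
    order. *)
Lemma card_positives : #|positives|.*2 = #|G|.-1.
Proof.
have cardN : #|[set - d | d in positives]| = #|positives|.
  by rewrite card_imset //; exact: oppr_inj.
rewrite -addnn -{2}cardN -cardsUI.
have memN d : (d \in [set - d | d in positives]) = (- d \in positives).
  apply/imsetP/idP => [[e eP ->] | dP]; first by rewrite opprK.
  by exists (- d); rewrite ?opprK.
have -> : positives :&: [set - d | d in positives] = set0.
  apply/setP => d; rewrite in_setI memN in_set0.
  by apply/negP => /andP[/positivesN/negPf->].
rewrite cards0 addn0 -(cardsC1 (0 : G)); congr #|pred_of_set _|.
apply/setP => d; rewrite in_setU memN !inE opprK -neq_ltn.
rewrite (inj_eq val_inj) (inj_eq enum_rank_inj).
by rewrite -addr_eq0 addrr_eq0.
Qed.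

(** * Random set completed by its uncovered elements *)

Definition uncovered A : {set G} :=
  [set x in ~: A | [forall a in A, forall a' in A,
                      (a != a') ==> (x + x != a + a')]].

Lemma half_saturatingU_uncovered A : half_saturating (A :|: uncovered A).
Proof.
apply/half_saturatingP => x; rewrite !inE negb_or negb_and => /andP[xA].
rewrite xA /= negb_forall_in => /exists_inP[a aA].
rewrite negb_forall_in => /exists_inP[a' a'A].
rewrite negb_imply negbK => /andP[aa' /eqP xx].
by exists a, a'; rewrite !inE aA a'A.
Qed.

Definition symmetric_pairs x : seq (G * G) :=
  [seq (x + d, x - d) | d <- enum positives].

Lemma uniq_symmetric_pairs x :
  uniq (x :: unzip1 (symmetric_pairs x) ++ unzip2 (symmetric_pairs x)).
Proof.
rewrite /unzip1 /unzip2 -!map_comp cons_uniq mem_cat negb_or cat_uniq.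
rewrite !map_inj_uniq ?enum_uniq; [|by move=> d e /addrI/oppr_inj|exact: addrI].
rewrite andbT; apply/andP; split.
  apply/andP; split; apply/mapP => -[d]; rewrite mem_enum => /positives_neq0 d0;
    by rewrite -[X in X = _]addr0 => /addrI/esym/eqP; rewrite ?oppr_eq0 (negPf d0).
apply/hasPn => _ /mapP[d + ->]; rewrite mem_enum => dP.
apply/mapP => -[e]; rewrite mem_enum => eP /addrI de.
by have := positivesN dP; rewrite de eP.
Qed.

(** [x + d] and [x - d] sum to [x + x] and are distinct because [d + d != 0]. *)
Lemma uncovered_avoid_pairs A x : x \in uncovered A ->
  (x \notin A) && all (fun c => ~~ ((c.1 \in A) && (c.2 \in A))) (symmetric_pairs x).
Proof.
rewrite inE in_setC => /andP[-> /forall_inP xU] /=.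
apply/allP => _ /mapP[d + ->] /=; rewrite mem_enum => dP.
apply/negP => /andP[/xU/forall_inP H /H].
rewrite addrACA subrr addr0 eqxx implybF negbK (inj_eq (addrI x)) -addr_eq0.
by rewrite addrr_eq0 (negPf (positives_neq0 dP)).
Qed.

Lemma sat_half_le_mean (R : realDomainType) (p : R) : 0 <= p <= 1 ->
  (sat_half G)%:R
    <= #|G|%:R * (p + (1 - p) * (1 - p ^+ 2) ^+ #|G|.-1./2).
Proof.
move=> p01; have /andP[p0 p1] := p01.
have card_sum (B : {set G}) : #|B|%:R = \sum_x (x \in B)%:R :> R.
  rewrite -sum1_card natr_sum [RHS](bigID (mem B)) /= [X in _ + X]big1.
    by rewrite addr0; apply: eq_bigr => x ->.
  by move=> x /negPf->.
pose avoid x A := (x \notin A) &&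
  all (fun c => ~~ ((c.1 \in A) && (c.2 \in A))) (symmetric_pairs x).
(* [F A] bounds [#|A| + #|uncovered A|] from above; the factor 1 gives the first sum the shape of
   [mean_in]. *)
pose F A : R := \sum_x (x \in A)%:R * 1 + \sum_x (avoid x A)%:R.
have [A FA] := le_mean_exists F p01.
have -> : #|G|%:R * (p + (1 - p) * (1 - p ^+ 2) ^+ #|G|.-1./2) = mean p F.
  rewrite meanD !mean_sum -big_split /= mulr_natl -sumr_const.
  apply: eq_bigr => x _; rewrite mean_in // mean1 mulr1.
  rewrite mean_avoid_pairs ?uniq_symmetric_pairs // size_map -cardE.
  by rewrite -card_positives doubleK.
apply: le_trans FA.
have := sat_half_le (half_saturatingU_uncovered A).
rewrite -(ler_nat R) => /le_trans; apply.
apply: (@le_trans _ _ (#|A| + #|uncovered A|)%:R).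
  by rewrite ler_nat cardsU leq_subr.
rewrite natrD !card_sum; apply: lerD.
  by apply: ler_sum => x _; rewrite mulr1.
apply: ler_sum => x _; rewrite ler_nat.
by case: (boolP (x \in uncovered A)) => // /uncovered_avoid_pairs;
  rewrite -/(avoid _ _) => ->.
Qed.

End OddOrder.

(** * Choice of [p] and numerical estimates *)

Theorem theorem1p15 (R : realType) (G : finZmodType) :
  odd #|G| -> (5 < #|G|)%N ->
  (sat_3AP G <= sat_half G)%N /\
  (sat_half G)%:R <=
    Num.sqrt ((#|G|%:R - 1) * ln (#|G|%:R - 1)) + Num.sqrt (#|G|%:R - 1) + 1 :> R.
Proof.
move=> oddG G5; split; first exact: sat_3AP_le_half.
pose k := #|G|.-1./2.
have cardG : #|G| = k.*2.+1
  by rewrite /k -card_positives // doubleK card_positives ?prednK // (ltn_trans _ G5).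
have -> : #|G|%:R - 1 = k.*2%:R :> R by rewrite cardG -addn1 natrD addrK.
set m : R := k.*2%:R.
have m1 : 1 <= m by rewrite ler1n; lia.
have m0 : 0 < m by apply: lt_le_trans m1.
have lnm0 : 0 <= ln m by rewrite ln_ge0.
have lnm : ln m <= m by apply: ltW; exact: ln_sublinear.
set s := Num.sqrt m.
have s0 : 0 < s by rewrite sqrtr_gt0.
have ss : s ^+ 2 = m by rewrite sqr_sqrtr // ltW.
have s1 : 1 <= s by rewrite -(sqrtr1 R) ler_sqrt.
pose p : R := Num.sqrt (ln m) / s.
have p2 : p ^+ 2 = ln m / m by rewrite expr_div_n ss sqr_sqrtr.
have p0 : 0 <= p by rewrite divr_ge0 ?sqrtr_ge0 // ltW.
have p1 : p <= 1 by rewrite ler_pdivrMr // mul1r ler_wsqrtr.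
have p21 : 0 <= 1 - p ^+ 2 by rewrite subr_ge0 exprn_ile1.
(* Squaring turns the exponent [k] into [m] and the bound into [m^-1], which equals
   [expR (- p ^+ 2)] to the power [m]; then [1 + t <= expR t] at [t = - p ^+ 2]. *)
have X : (1 - p ^+ 2) ^+ k <= s^-1.
  rewrite -(@ler_pXn2r _ 2) ?nnegrE ?exprn_ge0 ?invr_ge0 ?(ltW s0) //.
  rewrite -exprM muln2 exprVn ss.
  have -> : m^-1 = expR (- p ^+ 2) ^+ k.*2.
    rewrite -expRM_natl -/m p2 mulrN mulrCA divff ?gt_eqF // mulr1.
    by rewrite expRN lnK.
  by rewrite lerXn2r ?nnegrE ?expR_ge0 // expR_ge1Dx.
have := @sat_half_le_mean G oddG R p; rewrite p0 p1 -/k => /(_ isT) /le_trans; apply.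
have -> : #|G|%:R = s ^+ 2 + 1 by rewrite ss cardG -addn1 natrD.
have -> : Num.sqrt (m * ln m) = s ^+ 2 * p.
  by rewrite sqrtrM ?(ltW m0) // /p -/s; field; rewrite gt_eqF.
apply: (@le_trans _ _ ((s ^+ 2 + 1) * (p + (1 - p) * s^-1))).
  by rewrite ler_wpM2l ?addr_ge0 ?sqr_ge0 // lerD2l ler_wpM2l // subr_ge0.
have V1 : s^-1 <= 1 by rewrite invf_le1.
have sV : s ^+ 2 * s^-1 = s by rewrite expr2 mulfK // gt_eqF.
have q0 : 0 <= 1 - p by rewrite subr_ge0.
(* The three summands give the three terms of the bound: [(1 - p) * s <= s], and
   [p + (1 - p) * s^-1 <= 1] because [s >= 1]. *)
have -> : (s ^+ 2 + 1) * (p + (1 - p) * s^-1) =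
  s ^+ 2 * p + (1 - p) * (s ^+ 2 * s^-1) + (p + (1 - p) * s^-1) by ring.
rewrite sV; have : (1 - p) * s^-1 <= 1 - p by rewrite -[leRHS]mulr1 ler_wpM2l.
have : (1 - p) * s <= s by rewrite -[leRHS]mul1r ler_wpM2r ?(ltW s0) // gerBl.
lra.
Qed.
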